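(* Under the setting below (with $q<q_c$ and $\hat{q}<q_c$), the certainty-equivalence controller $\hat{u}_t=\hat{K}x_t$ with $\hat{K}=-(R+B^{\top}\hat{P}B)^{-1}B^{\top}\hat{P}A$ mean-square stabilizes the system $x_{t+1}=Ax_t+\lambda_tBu_t$ if $q$ and $\hat{q}$ satisfy $$Q+(1-q)\hat{K}^{\top}R\hat{K}-(q-\hat{q})A^{\top}\hat{P}B(R+B^{\top}\hat{P}B)^{-1}B^{\top}\hat{P}A>0,$$ where $\hat{P}$ is the positive definite solution of $\hat{P}=Q+A^{\top}\hat{P}A-(1-\hat{q})A^{\top}\hat{P}B(R+B^{\top}\hat{P}B)^{-1}B^{\top}\hat{P}A$. Moreover, if $\hat{q}\ge q$, this matrix inequality always holds.
   Context: Consider the discrete-time system $x_{t+1}=Ax_t+\lambda_tBu_t$, $t=0,1,2,\dots$, with $x_t\in\mathbb{R}^n$, $u_t\in\mathbb{R}^m$, $x_0$ having finite mean and variance, and $\{\lambda_t\}$ i.i.d. Bernoulli random variables with $\lambda_t=0$ with probability $q\in(0,1)$ (packet loss) and $\lambda_t=1$ with probability $1-q$. The cost is $J(x_0,\mathbf{u})=\mathbb{E}\{\sum_{t=0}^\infty x_t^{\top}Qx_t+\lambda_tu_t^{\top}Ru_t\}$ with $Q,R$ positive definite, and $(A,B)$ is stabilizable. Assume $q<q_c$, where $q_c$ is the critical loss probability guaranteeing existence of a positive definite solution $P$ to the modified Riccati equation $P=Q+A^{\top}PA-(1-q)A^{\top}PB(R+B^{\top}PB)^{-1}B^{\top}PA$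 (with $1/\prod_i|\lambda_i^u(A)|^2\le q_c\le 1/\max_i|\lambda_i^u(A)|^2$, $\lambda_i^u(A)$ the unstable eigenvalues of $A$). The unknown $q$ is estimated by $\hat{q}=\frac{1}{N_q}\sum_{i=1}^{N_q}(1-\lambda_i)$ from channel samples, and it is assumed that $\hat{q}<q_c$. The system is mean-square stable if $\lim_{t\to\infty}\mathbb{E}\{x_t^{\top}x_t\}=0$.
   Formalization: The initial state x_0 is assumed independent of the packet losses λ_t, a standard convention the text leaves unstated; without it the claim fails, e.g. for a scalar unstable system whose x_0 grows with the length of the initial run of losses. *)

(* Defs.v *)
From HB Require Import structures.
From mathcomp Require Import all_boot all_order all_algebra.
From mathcomp Require Import all_classical all_reals all_analysis.
Set Implicit Arguments. Unset Strict Implicit. Unset Printing Implicit Defensive.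
Import Order.TTheory GRing.Theory Num.Theory numFieldNormedType.Exports.
Local Open Scope classical_set_scope.
Local Open Scope ring_scope.

Section Defs.
Variable R : realType.

Definition posdef n (M : 'M[R]_n) : Prop :=
  M^T = M /\ forall x : 'cV[R]_n, x != 0 -> 0 < (x^T *m M *m x) 0 0.

(* Schur stability: powers converge to zero (equivalently spectral radius < 1) *)
Definition schur_stable n (M : 'M[R]_n) : Prop :=
  forall i j : 'I_n, (M ^+ k) i j @[k --> \oo] --> 0.

Definition stabilizable n m (A : 'M[R]_n) (B : 'M[R]_(n, m)) : Prop :=
  exists K : 'M[R]_(m, n), schur_stable (A + B *m K).

Definition riccati_term n m (A : 'M[R]_n) (B : 'M[R]_(n, m)) (Rm : 'M[R]_m)
  (P : 'M[R]_n) : 'M[R]_n :=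
  A^T *m P *m B *m invmx (Rm + B^T *m P *m B) *m B^T *m P *m A.

Definition mare_rhs n m (A : 'M[R]_n) (B : 'M[R]_(n, m)) (Q : 'M[R]_n)
  (Rm : 'M[R]_m) (q : R) (P : 'M[R]_n) : 'M[R]_n :=
  Q + A^T *m P *m A - (1 - q) *: riccati_term A B Rm P.

Definition mare_pd_solution n m (A : 'M[R]_n) (B : 'M[R]_(n, m)) (Q : 'M[R]_n)
  (Rm : 'M[R]_m) (q : R) (P : 'M[R]_n) : Prop :=
  posdef P /\ P = mare_rhs A B Q Rm q P.

Definition critical_prob n m (A : 'M[R]_n) (B : 'M[R]_(n, m)) (Q : 'M[R]_n)
  (Rm : 'M[R]_m) : R :=
  sup [set q' : R | 0 <= q' <= 1 /\
        forall q'', 0 <= q'' <= q' -> exists P, mare_pd_solution A B Q Rm q'' P].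

Definition ce_gain n m (A : 'M[R]_n) (B : 'M[R]_(n, m)) (Rm : 'M[R]_m)
  (P : 'M[R]_n) : 'M[R]_(m, n) :=
  - (invmx (Rm + B^T *m P *m B) *m B^T *m P *m A).

Definition ce_condition_matrix n m (A : 'M[R]_n) (B : 'M[R]_(n, m))
  (Q : 'M[R]_n) (Rm : 'M[R]_m) (q qhat : R) (Phat : 'M[R]_n) : 'M[R]_n :=
  let K := ce_gain A B Rm Phat in
  Q + (1 - q) *: (K^T *m Rm *m K) - (q - qhat) *: riccati_term A B Rm Phat.

Fixpoint cl_state n m (A : 'M[R]_n) (B : 'M[R]_(n, m)) (K : 'M[R]_(m, n))
  (T : Type) (x0 : T -> 'cV[R]_n) (lam : nat -> T -> bool) (t : nat) (w : T)
  : 'cV[R]_n :=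
  match t with
  | 0 => x0 w
  | t'.+1 => A *m cl_state A B K x0 lam t' w
             + (lam t' w : nat)%:R *: (B *m (K *m cl_state A B K x0 lam t' w))
  end.

End Defs.

Section Prob.
Variables (d : measure_display) (T : measurableType d) (R : realType).
Variable (P : probability T R).

Definition finite_second_moment n (x0 : T -> 'cV[R]_n) : Prop :=
  forall i : 'I_n, measurable_fun setT (fun w => x0 w i 0) /\
    ('E_P[fun w => ((x0 w i 0) ^+ 2)%R] < +oo)%E.

Definition bernoulli_loss (q : R) (lam : nat -> T -> bool) : Prop :=
  forall t, (forall b, measurable [set w | lam t w = b]) /\
    P [set w | lam t w = false] = q%:E.

(* x0, lam_0, lam_1, ... mutually independent (product rule on the
   generating pi-system: rectangles for x0, point events for each lam_t) *)
Definition indep_init_loss n (x0 : T -> 'cV[R]_n) (lam : nat -> T -> bool)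
  : Prop :=
  forall (N : nat) (bs : nat -> bool) (Bs : 'I_n -> set R),
    (forall i, measurable (Bs i)) ->
    P ([set w | forall i, Bs i (x0 w i ord0)] `&`
       [set w | forall t, (t < N)%N -> lam t w = bs t]) =
    (P [set w | forall i, Bs i (x0 w i ord0)] *
     (\prod_(t < N) fine (P [set w | lam t w = bs t]))%:E)%E.

Definition ms_stable n (x : nat -> T -> 'cV[R]_n) : Prop :=
  ('E_P[fun w => ((x t w)^T *m x t w) ord0 ord0] @[t --> \oo] --> 0)%E.

End Prob.

(* Main.v *)
Require Import Defs.
From HB Require Import structures.
From mathcomp Require Import all_boot all_order all_algebra.
From mathcomp Require Import all_classical all_reals all_analysis.
From mathcomp Require Import measurable_realfun.
From mathcomp Require Import ring lra.
Set Implicit Arguments.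
Unset Strict Implicit.
Unset Printing Implicit Defensive.
Import Order.TTheory GRing.Theory Num.Theory numFieldNormedType.Exports.
Local Open Scope classical_set_scope.
Local Open Scope ring_scope.

(* With S = R + B'PB and gain K, K'SK is the Riccati term, and the modified
   Riccati equation for qhat becomes the drift identity
     q (Ax)'P(Ax) + (1-q) ((A+BK)x)'P((A+BK)x) = x'Px - x'Mx,
   M being the condition matrix. If M > 0, the left side is at most r x'Px for
   some r < 1. On each finite loss path x_t = Z x_0 with Z deterministic, so
   splitting on the next loss shows by induction that E|x_t|^2 = O(r^t). If
   q <= qhat, M is Q plus two positive semidefinite terms. *)

(** * Quadratic forms and positive definite matrices *)

Definition qform (R : realType) (n : nat) (M : 'M[R]_n) (x : 'cV[R]_n) : R :=
  (x^T *m M *m x) 0 0.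

Section QuadraticForms.
Variable R : realType.
Implicit Types n m : nat.

Lemma qform0 n (M : 'M[R]_n) : qform M 0 = 0.
Proof. by rewrite /qform mulmx0 mxE. Qed.

Lemma qformD n (M N : 'M[R]_n) x : qform (M + N) x = qform M x + qform N x.
Proof. by rewrite /qform mulmxDr mulmxDl mxE. Qed.

Lemma qformN n (M : 'M[R]_n) x : qform (- M) x = - qform M x.
Proof. by rewrite /qform mulmxN mulNmx mxE. Qed.

Lemma qformZ n a (M : 'M[R]_n) x : qform (a *: M) x = a * qform M x.
Proof. by rewrite /qform -scalemxAr -scalemxAl mxE. Qed.

Lemma qform_mul n m (M : 'M[R]_n) (L : 'M[R]_(n, m)) x :
  qform M (L *m x) = qform (L^T *m M *m L) x.
Proof. by rewrite /qform trmx_mul !mulmxA. Qed.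

Lemma posdef_qform_ge0 n (M : 'M[R]_n) x : posdef M -> 0 <= qform M x.
Proof.
move=> [_ M0]; have [->|x0] := eqVneq x 0; first by rewrite qform0.
exact/ltW/M0.
Qed.

Lemma posdef_unitmx n (M : 'M[R]_n) : posdef M -> M \in unitmx.
Proof.
move=> [_ M0]; rewrite -row_free_unit; apply: inj_row_free => v vM0.
apply/eqP/negP => /negP v0.
have := M0 v^T; rewrite trmxK vM0 mul0mx mxE ltxx => /(_ _) H.
by apply/notF/H; apply: contra v0 => /eqP vT0; rewrite -[v]trmxK vT0 trmx0.
Qed.

Lemma qform_cauchy_schwarz n (M : 'M[R]_n) (x y : 'cV[R]_n) : posdef M ->
  ((x^T *m M *m y) 0 0) ^+ 2 <= qform M x * qform M y.
Proof.
move=> pM; have [sM _] := pM.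
set b := (_ 0 0).
have yxE : (y^T *m M *m x) 0 0 = b.
  have -> : y^T *m M *m x = (x^T *m M *m y)^T.
    by rewrite !trmx_mul trmxK sM mulmxA.
  by rewrite mxE.
have key s t : 0 <= s ^+ 2 * qform M x + 2 * s * t * b + t ^+ 2 * qform M y.
  have := posdef_qform_ge0 (s *: x + t *: y) pM.
  suff -> : qform M (s *: x + t *: y) =
     s ^+ 2 * qform M x + 2 * s * t * b + t ^+ 2 * qform M y by [].
  have trE : (s *: x + t *: y)^T = s *: x^T + t *: y^T.
    by rewrite linearD/= !linearZ.
  rewrite /qform trE !(mulmxDl, mulmxDr).
  rewrite -!(scalemxAl, scalemxAr) !scalerA !mxE -/b.
  have := yxE; rewrite /b /qform !mxE => ->. ring.
have x0 := posdef_qform_ge0 x pM.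
have [xz|xnz] := eqVneq (qform M x) 0.
  suff -> : b = 0 by rewrite expr0n xz mul0r.
  have [x_eq0|/(pM.2)] := eqVneq x 0.
    by rewrite /b x_eq0 trmx0 !mul0mx mxE.
  by rewrite -/(qform M x) xz ltxx.
have {}x0 : 0 < qform M x by rewrite lt_def xnz.
(* For fixed [t = qform M x] the choice [s = - b] minimises the form at [s *: x + t *: y]. The value
   there factors as [u * (u * v - b ^+ 2)], and [u > 0] can be cancelled. *)
have := key (- b) (qform M x).
move=> disc; rewrite -subr_ge0 -(pmulr_rge0 _ x0); move: disc.
move: (qform M x) (qform M y) => u v.
suff -> : (- b) ^+ 2 * u + 2 * - b * u * b + u ^+ 2 * v = u * (u * v - b ^+ 2).
  by [].
ring.
Qed.

Lemma posdef1 n : posdef (1%:M : 'M[R]_n).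
Proof.
split; first by rewrite trmx1.
move=> x x0; rewrite mulmx1 mxE.
have [i xi0] : exists i, x i 0 != 0.
  apply/existsP; rewrite -negb_forall; apply: contra x0 => /forallP x0.
  by apply/eqP/colP => i; rewrite mxE; apply/eqP.
rewrite (bigD1 i)//= ltr_pwDl//.
  by rewrite mxE -expr2 lt_def sqr_ge0 sqrf_eq0 xi0.
by apply: sumr_ge0 => j _; rewrite mxE -expr2 sqr_ge0.
Qed.

Lemma qform1E n (x : 'cV[R]_n) : qform 1%:M x = \sum_i (x i 0) ^+ 2.
Proof. by rewrite /qform mulmx1 mxE; apply: eq_bigr => i _; rewrite mxE expr2. Qed.

(* x_i is the M-inner product of M^-1 e_i with x, so Cauchy-Schwarz bounds it. *)
Lemma posdef_coercive n (M : 'M[R]_n) : posdef M ->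
  exists2 c : R, 0 <= c & forall x, qform 1%:M x <= c * qform M x.
Proof.
move=> pM; have uM := posdef_unitmx pM.
pose z (i : 'I_n) := invmx M *m (delta_mx i 0 : 'cV[R]_n).
exists (\sum_i qform M (z i)).
  by apply: sumr_ge0 => i _; exact: posdef_qform_ge0.
move=> x; rewrite qform1E mulr_suml; apply: ler_sum => i _.
apply: le_trans (qform_cauchy_schwarz (z i) x pM).
suff -> : (z i)^T *m M *m x = ((delta_mx i 0 : 'cV[R]_n)^T *m x).
  by rewrite trmx_delta -rowE mxE.
by rewrite trmx_mul trmx_inv (proj1 pM) -!mulmxA (mulmxA (invmx M)) mulVmx// mul1mx.
Qed.

Lemma qform_bounded n (M : 'M[R]_n) : exists2 c : R, 0 <= c &
  forall x, qform M x <= c * qform 1%:M x.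
Proof.
(* Each product of two coordinates is at most the squared norm in absolute value, so the absolute
   values of the entries of [M] add up to a bound. *)
exists (\sum_i \sum_j `|M i j|).
  by apply: sumr_ge0 => i _; apply: sumr_ge0.
move=> x.
have xi i : `|x i 0| ^+ 2 <= qform 1%:M x.
  rewrite qform1E (bigD1 i)//= real_normK ?num_real// lerDl.
  by apply: sumr_ge0 => j _; exact: sqr_ge0.
move: (qform 1%:M x) xi => X xi.
rewrite /qform -mulmxA mxE mulr_suml; apply: ler_sum => i _.
rewrite !mxE mulr_sumr mulr_suml; apply: ler_sum => j _.
apply: le_trans (ler_norm _) _; rewrite !normrM mulrCA ler_wpM2l//.
have := xi i; have := xi j.
by have := sqr_ge0 (`|x i 0| - `|x j 0|); nra.
Qed.

(** Coercivity of [M] and boundedness of [N] give [N <= k |.|^2 <= k c M] as forms, so subtracting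
    [M] removes a fixed fraction of [N]. This turns the strict matrix inequality into a uniform
    contraction factor. *)
Lemma posdef_le_scale n (M N : 'M[R]_n) : posdef M ->
  exists2 r : R, 0 <= r < 1 & forall x, qform N x >= 0 ->
    qform N x - qform M x <= r * qform N x.
Proof.
move=> pM; have [c c0 cM] := posdef_coercive pM.
have [k k0 kN] := qform_bounded N.
have d0 : 0 < 1 + k * c by have := mulr_ge0 k0 c0; lra.
(* The added 1 keeps the denominator positive even when [k * c = 0]. *)
exists (1 - (1 + k * c)^-1).
  have i0 : 0 < (1 + k * c)^-1 by rewrite invr_gt0.
  have i1 : (1 + k * c)^-1 <= 1 by rewrite invf_le1// lerDl mulr_ge0.
  by apply/andP; split; lra.
move=> x N0; rewrite mulrBl mul1r lerB// mulrC ler_pdivrMr//.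
have M0 := posdef_qform_ge0 x pM.
have := ler_wpM2l k0 (cM x); have := kN x; lra.
Qed.

End QuadraticForms.

(** * The Riccati term, the drift identity and the condition matrix *)

Section Riccati.
Variables (R : realType) (n m : nat).
Variables (A : 'M[R]_n) (B : 'M[R]_(n, m)) (Q : 'M[R]_n) (Rm : 'M[R]_m).
Variables (P : 'M[R]_n).
Hypothesis (pRm : posdef Rm) (pP : posdef P).

Let S := Rm + B^T *m P *m B.
Let K := ce_gain A B Rm P.

Lemma posdef_innovation : posdef S.
Proof.
split; first by rewrite /S linearD/= !trmx_mul trmxK pRm.1 pP.1 mulmxA.
move=> x x0; rewrite -/(qform S x) qformD -qform_mul ltr_pwDl//.
  exact: pRm.2.
exact: posdef_qform_ge0.
Qed.

Let uS := posdef_unitmx posdef_innovation.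

Lemma mul_innovation_gain : S *m K = - (B^T *m P *m A).
Proof. by rewrite /K /ce_gain -/S mulmxN !mulmxA mulmxV// mul1mx. Qed.

Lemma trmx_gain_mul_innovation : K^T *m S = - (A^T *m P *m B).
Proof.
rewrite -[in LHS]posdef_innovation.1 -trmx_mul mul_innovation_gain.
by rewrite linearN/= !trmx_mul trmxK pP.1 mulmxA.
Qed.

(** This congruence form removes the inverse: it shows that the term is positive semidefinite and
    lets it be compared with [K^T *m Rm *m K]. *)
Lemma riccati_termE : riccati_term A B Rm P = K^T *m S *m K.
Proof.
by rewrite trmx_gain_mul_innovation /K /ce_gain mulmxN mulNmx opprK !mulmxA.
Qed.

Lemma gain_drift (q qhat : R) (x : 'cV[R]_n) :
  P = mare_rhs A B Q Rm qhat P ->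
  q * qform P (A *m x) + (1 - q) * qform P ((A + B *m K) *m x) =
  qform P x - qform (ce_condition_matrix A B Q Rm q qhat P) x.
Proof.
move=> PE; rewrite !qform_mul.
(* Completing the square: with [G] the Riccati term, each cross term is [- G], and the term
   quadratic in [K] is [G - K^T *m Rm *m K], since [B^T *m P *m B = S - Rm]. *)
have -> : (A + B *m K)^T *m P *m (A + B *m K) = A^T *m P *m A
   - riccati_term A B Rm P - K^T *m Rm *m K.
  have H1 : A^T *m P *m (B *m K) = - riccati_term A B Rm P.
    by rewrite riccati_termE trmx_gain_mul_innovation mulNmx opprK mulmxA.
  have H2 : K^T *m B^T *m P *m A = - riccati_term A B Rm P.
    by rewrite riccati_termE -(mulmxA K^T S) mul_innovation_gain mulmxN opprK !mulmxA.
  have H3 : K^T *m B^T *m P *m (B *m K)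
      = riccati_term A B Rm P - K^T *m Rm *m K.
    by rewrite riccati_termE /S mulmxDr mulmxDl addrAC subrr add0r !mulmxA.
  have -> : (A + B *m K)^T = A^T + K^T *m B^T by rewrite linearD/= trmx_mul.
  rewrite !mulmxDl !mulmxDr H1 H2 H3.
  move: (riccati_term _ _ _ _) (A^T *m P *m A) (K^T *m Rm *m K) => G L N.
  by apply/matrixP => i j; rewrite !mxE; ring.
(* The Riccati equation is used only for the [P] on the right. The coefficients of the Riccati term
   then add up to [-(1 - qhat) + (q - qhat) = -(1 - q)], so [qhat] cancels. *)
have -> : qform P x = qform (mare_rhs A B Q Rm qhat P) x by rewrite -PE.
rewrite /ce_condition_matrix -/K /mare_rhs !(qformD, qformN, qformZ).
ring.
Qed.

Lemma posdef_ce_condition (q qhat : R) : posdef Q -> q <= 1 -> q <= qhat ->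
  posdef (ce_condition_matrix A B Q Rm q qhat P).
Proof.
move=> pQ q1 qq; split.
  have trK (N : 'M[R]_m) : N^T = N -> (K^T *m N *m K)^T = K^T *m N *m K.
    by move=> NE; rewrite !trmx_mul trmxK NE mulmxA.
  rewrite /ce_condition_matrix -/K riccati_termE.
  rewrite [LHS]linearB/= [(_ + _)^T]linearD/= ![(_ *: _)^T]linearZ/=.
  by rewrite pQ.1 (trK _ pRm.1) (trK _ posdef_innovation.1).
move=> x x0; rewrite -/(qform _ x) /ce_condition_matrix -/K riccati_termE.
rewrite !(qformD, qformN, qformZ) -!qform_mul.
have := pQ.2 x x0; rewrite -/(qform Q x).
have q1_ge0 : 0 <= 1 - q by rewrite subr_ge0.
have qq_ge0 : 0 <= qhat - q by rewrite subr_ge0.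
have := mulr_ge0 q1_ge0 (posdef_qform_ge0 (K *m x) pRm).
have := mulr_ge0 qq_ge0 (posdef_qform_ge0 (K *m x) posdef_innovation).
lra.
Qed.

End Riccati.

(** * Integrals over an event independent of a random variable *)

Section ConditionalIntegral.
Context d (T : measurableType d) (R : realType).
Variable P : probability T R.

(** The restricted measure gives no mass to the complement of [E] and agrees with [P] inside it. The
    event is thus absorbed into a measure, which can then be pushed forward. *)
Lemma integral_mrestr (E : set T) (mE : measurable E) (f : T -> \bar R) :
  measurable_fun setT f -> (forall w, (0 <= f w)%E) ->
  (\int[mrestr P mE]_w f w = \int[P]_(w in E) f w)%E.
Proof.
move=> mf f0.
rewrite (@ge0_negligible_integral _ _ _ (mrestr P mE) _ (~` E))//.
- rewrite setTD setCK; apply: eq_measure_integral => A mA AE.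
  by rewrite /= /mrestr (setIidl AE).
- exact: measurableC.
- by rewrite /= /mrestr setICl measure0.
Qed.

(** The product rule says that the image under [X] of [P] restricted to [E] is [c] times the law of
    [X]; both integrals are then computed on the real line. *)
Lemma integral_indep_event (E : set T) (X : {mfun T >-> R}) (f : R -> \bar R)
    (c : {nonneg R}) :
  measurable E -> measurable_fun setT f -> (forall y, (0 <= f y)%E) ->
  (forall Y, measurable Y -> (P ((X @^-1` Y) `&` E) = P (X @^-1` Y) * c%:num%:E)%E) ->
  (\int[P]_(w in E) f (X w) = c%:num%:E * \int[P]_w f (X w))%E.
Proof.
move=> mE mf f0 indep.
have mfX : measurable_fun setT (f \o X) by exact: measurableT_comp.
rewrite -(@integral_mrestr E mE (f \o X))//; last by move=> w; exact: f0.
have mX : measurable_fun setT X by [].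
rewrite -(@ge0_integral_pushforward _ _ _ _ _ _ mX (mrestr P mE) setT f)//.
rewrite -(@ge0_integral_pushforward _ _ _ _ _ _ mX P setT f)//.
rewrite -ge0_integral_mscale//.
apply: eq_measure_integral => Y mY _.
by rewrite /= /pushforward /mrestr /mscale /= indep// muleC.
Qed.

End ConditionalIntegral.

(** * Loss paths and the states along them *)

Section Trajectories.
Context d (T : measurableType d) (R : realType).
Variables (P : probability T R) (n m : nat).
Variables (A : 'M[R]_n) (B : 'M[R]_(n, m)) (K : 'M[R]_(m, n)) (q : R).
Variables (x0 : T -> 'cV[R]_n) (lam : nat -> T -> bool).
Hypothesis (q01 : 0 <= q <= 1).
Hypothesis (x0_moment : finite_second_moment P x0).
Hypothesis (lam_loss : bernoulli_loss P q lam).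
Hypothesis (indep : indep_init_loss P x0 lam).

Let x := cl_state A B K x0 lam.

Definition channel_prob (b : bool) : R := if b then 1 - q else q.

(** The prescription is an infinite sequence of which only the first [N] entries are read, as in
    [indep_init_loss]; this avoids tuples of varying length. *)
Definition loss_path N (bs : nat -> bool) : set T :=
  [set w | forall t, (t < N)%N -> lam t w = bs t].

Definition loss_path_prob N (bs : nat -> bool) : R :=
  \prod_(t < N) channel_prob (bs t).

Definition extend_path (bs : nat -> bool) N b : nat -> bool :=
  fun t => if t == N then b else bs t.

Lemma channel_prob_ge0 b : 0 <= channel_prob b.
Proof. by have /andP[q0 q1] := q01; case: b; rewrite /channel_prob; lra. Qed.

Lemma loss_path_prob_ge0 N bs : 0 <= loss_path_prob N bs.
Proof. by apply: prodr_ge0 => t _; exact: channel_prob_ge0. Qed.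

Lemma probability_channel t b : P [set w | lam t w = b] = (channel_prob b)%:E.
Proof.
have [mlam lamF] := lam_loss t.
case: b => //=; rewrite (_ : [set _ | _] = ~` [set w | lam t w = false]).
  by rewrite probability_setC// lamF -EFinB.
by apply/seteqP; split => w /=; case: (lam t w).
Qed.

Lemma loss_pathS N bs b : loss_path N.+1 (extend_path bs N b) =
  loss_path N bs `&` [set w | lam N w = b].
Proof.
apply/seteqP; split => w /=.
- move=> H; split; last by rewrite H// /extend_path eqxx.
  by move=> t tN; rewrite (H t (ltnW tN)) /extend_path ltn_eqF.
- move=> [H HN] t; rewrite ltnS leq_eqVlt /extend_path => /orP[/eqP->|tN].
    by rewrite eqxx.
  by rewrite ltn_eqF// H.
Qed.

Lemma loss_path_probS N bs b : loss_path_prob N.+1 (extend_path bs N b) =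
  loss_path_prob N bs * channel_prob b.
Proof.
rewrite /loss_path_prob big_ord_recr/= /extend_path eqxx; congr (_ * _).
by apply: eq_bigr => t _; rewrite ltn_eqF.
Qed.

Lemma measurable_loss_path N bs : measurable (loss_path N bs).
Proof.
elim: N bs => [|N IH] bs.
  by rewrite (_ : loss_path 0 bs = setT)//; apply/seteqP; split.
(* Overwriting entry [N] by itself puts any path in the form that [loss_pathS] decomposes. *)
have -> : bs = extend_path bs N (bs N).
  by apply/funext => t; rewrite /extend_path; case: eqP => [->|].
by rewrite loss_pathS; apply: measurableI => //; exact: (lam_loss N).1.
Qed.

Lemma loss_path_split N bs : loss_path N bs =
  loss_path N.+1 (extend_path bs N false) `|`
  loss_path N.+1 (extend_path bs N true).
Proof.
rewrite !loss_pathS -setIUr; apply/seteqP; split => w /=; last by case.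
by move=> ?; split=> //; case: (lam N w); [right|left].
Qed.

Lemma loss_path_disj N bs : [disjoint loss_path N.+1 (extend_path bs N false)
  & loss_path N.+1 (extend_path bs N true)].
Proof.
rewrite !loss_pathS disj_set2E; apply/eqP/seteqP; split => // w /=.
by move=> [[_ ->]] [].
Qed.

Lemma measurable_init i : measurable_fun setT (fun w => x0 w i 0).
Proof. exact: (x0_moment i).1. Qed.

Lemma measurable_state t i : measurable_fun setT (fun w => x t w i 0).
Proof.
elim: t i => [|t IH] i; first exact: measurable_init.
have mZ (Z : 'M[R]_n) : measurable_fun setT (fun w => (Z *m x t w) i 0).
  under eq_fun do rewrite mxE.
  by apply: measurable_sum => j; apply: measurable_funM.
have mlam : measurable_fun setT (fun w => (lam t w : nat)%:R : R).
  rewrite (_ : (fun _ => _) = \1_[set w | lam t w = true]).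
    by apply: measurable_indic; exact: (lam_loss t).1.
  apply/funext => w; rewrite indicE; congr (nat_of_bool _)%:R.
  by apply/idP/idP; rewrite inE.
rewrite (_ : (fun _ => _) = fun w => (A *m x t w) i 0 +
   (lam t w : nat)%:R * ((B *m K) *m x t w) i 0); last first.
  by apply/funext => w /=; rewrite -mulmxA [LHS]mxE; congr (_ + _); rewrite [LHS]mxE.
by apply: measurable_funD => //; apply: measurable_funM.
Qed.

Lemma measurable_sqnorm_state t :
  measurable_fun setT (fun w => (qform 1%:M (x t w))%:E).
Proof.
apply/measurable_EFinP; under eq_fun do rewrite qform1E.
by apply: measurable_sum => i; apply: measurable_funX; exact: measurable_state.
Qed.

Lemma qform1_ge0 (y : 'cV[R]_n) : 0 <= qform 1%:M y.
Proof. by apply: posdef_qform_ge0; exact: posdef1. Qed.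

Let init_energy : \bar R := (\int[P]_w (qform 1%:M (x0 w))%:E)%E.

(** Finiteness lets the later estimates be carried out in the reals. *)
Lemma init_energy_fin : init_energy \is a fin_num.
Proof.
rewrite ge0_fin_numE; last first.
  by apply: integral_ge0 => w _; rewrite lee_fin qform1_ge0.
rewrite /init_energy.
under eq_integral do rewrite qform1E -sumEFin.
rewrite ge0_integral_sum//; last 2 first.
- move=> i; apply/measurable_EFinP/measurable_funX; exact: measurable_init.
- by move=> i w _; rewrite lee_fin sqr_ge0.
apply: lte_sum_pinfty => i _.
by have := (x0_moment i).2; rewrite unlock.
Qed.

Lemma integral_init_loss_path N bs :
  (\int[P]_(w in loss_path N bs) (qform 1%:M (x0 w))%:E =
   (loss_path_prob N bs)%:E * init_energy)%E.
Proof.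
rewrite /init_energy.
under eq_integral do rewrite qform1E -sumEFin.
under [in RHS]eq_integral do rewrite qform1E -sumEFin.
have mx i : measurable_fun setT (fun w => (x0 w i 0 ^+ 2)%:E).
  by apply/measurable_EFinP/measurable_funX; exact: measurable_init.
rewrite !ge0_integral_sum//; last 4 first.
- by move=> i w _; rewrite lee_fin sqr_ge0.
- exact: measurable_loss_path.
- by move=> i; exact: measurable_funTS.
- by move=> i w _; rewrite lee_fin sqr_ge0.
rewrite ge0_sume_distrr; last first.
  by move=> i _; apply: integral_ge0 => w _; rewrite lee_fin sqr_ge0.
apply: eq_bigr => i _.
pose X : {mfun T >-> R} := mfun_Sub (mem_set (measurable_init i)).
pose c : {nonneg R} := NngNum (loss_path_prob_ge0 N bs).
apply: (@integral_indep_event _ _ _ P (loss_path N bs) X (fun y => (y ^+ 2)%:E) c).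
- exact: measurable_loss_path.
- by apply/measurable_EFinP; exact: measurable_funX.
- by move=> y; rewrite lee_fin sqr_ge0.
move=> Y mY.
(* A rectangle whose sides are all full except the [i]-th extracts from the joint product rule the
   independence of the single coordinate [i]. *)
pose Bs (j : 'I_n) : set R := if j == i then Y else setT.
have mBs j : measurable (Bs j) by rewrite /Bs; case: ifP.
have BsE : [set w | forall j, Bs j (x0 w j ord0)] = X @^-1` Y.
  apply/seteqP; split => w /=.
    by move=> /(_ i); rewrite /Bs eqxx.
  by move=> Yw j; rewrite /Bs; case: eqP => [->|].
have := @indep N bs Bs mBs; rewrite BsE => ->; congr (_ * _%:E)%E.
by apply: eq_bigr => t _; rewrite probability_channel.
Qed.

(** * Geometric decay from a quadratic Lyapunov form *)

Variables (V : 'M[R]_n) (r C : R).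
Hypothesis (r_ge0 : 0 <= r) (C_ge0 : 0 <= C).
Hypothesis V_ge0 : forall y, 0 <= qform V y.
Hypothesis V_coercive : forall y, qform 1%:M y <= C * qform V y.
Hypothesis V_contracts : forall y,
  q * qform V (A *m y) + (1 - q) * qform V ((A + B *m K) *m y) <= r * qform V y.

(** This is the trace of [Z^T *m V *m Z]; in column form it inherits the contraction of [V] term by
    term. *)
Let energy (Z : 'M[R]_n) : R := \sum_j qform V (col j Z).

(** The squared Frobenius norm of [Z] is the intermediate bound: Cauchy-Schwarz on the rows bounds
    the left side by it, and coercivity on the columns bounds it by [C * energy Z]. *)
Lemma qform1_mulmx_le (Z : 'M[R]_n) y :
  qform 1%:M (Z *m y) <= C * energy Z * qform 1%:M y.
Proof.
rewrite /energy mulr_sumr.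
apply: (@le_trans _ _ ((\sum_j qform 1%:M (col j Z)) * qform 1%:M y)); last first.
  by rewrite ler_wpM2r ?qform1_ge0//; apply: ler_sum => j _.
have -> : \sum_j qform 1%:M (col j Z) = \sum_i qform 1%:M ((row i Z)^T).
  under eq_bigr do rewrite qform1E.
  under [RHS]eq_bigr do rewrite qform1E.
  rewrite exchange_big; apply: eq_bigr => i _; apply: eq_bigr => j _.
  by rewrite !mxE.
rewrite qform1E mulr_suml; apply: ler_sum => i _.
apply: le_trans (qform_cauchy_schwarz _ _ (posdef1 R n)).
by rewrite trmxK mulmx1 -row_mul [row _ _ _ _]mxE.
Qed.

Lemma energy_contracts Z :
  q * energy (A *m Z) + (1 - q) * energy ((A + B *m K) *m Z) <= r * energy Z.
Proof.
rewrite /energy !mulr_sumr -big_split/=; apply: ler_sum => j _.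
by rewrite !colE -!mulmxA -!colE.
Qed.

(* On a loss path of length [N] the state is a deterministic linear image of
   [x0], so independence is only ever used for the coordinates of [x0]. *)
Lemma integral_sqnorm_state_le k N bs (Z : 'M[R]_n) :
  (forall w, loss_path N bs w -> x N w = Z *m x0 w) ->
  (\int[P]_(w in loss_path N bs) (qform 1%:M (x (N + k)%N w))%:E <=
   (loss_path_prob N bs * (C * r ^+ k * energy Z))%:E * init_energy)%E.
Proof.
elim: k N bs Z => [|k IH] N bs Z xE.
  rewrite addn0 expr0 mulr1.
  have CZ0 : 0 <= C * energy Z by rewrite mulr_ge0// sumr_ge0.
  rewrite mulrC EFinM -muleA -integral_init_loss_path -ge0_integralZl//; last 3 first.
  - exact: measurable_loss_path.
  - exact: measurable_funTS (measurable_sqnorm_state 0).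
  - by move=> w _; rewrite lee_fin qform1_ge0.
  apply: ge0_le_integral.
  - exact: measurable_loss_path.
  - by move=> w _; rewrite lee_fin qform1_ge0.
  - exact: measurable_funTS (measurable_sqnorm_state N).
  - apply: emeasurable_funM => //.
    exact: measurable_funTS (measurable_sqnorm_state 0).
  - by move=> w /xE ->; rewrite -EFinM lee_fin qform1_mulmx_le.
rewrite loss_path_split ge0_integral_setU//; last 5 first.
- exact: measurable_loss_path.
- exact: measurable_loss_path.
- exact: measurable_funTS (measurable_sqnorm_state _).
- by move=> w _; rewrite lee_fin qform1_ge0.
- exact: loss_path_disj.
(* The next loss lengthens the path by one and leaves one step fewer to go. The induction hypothesis
   applies with [Z] replaced by [A *m Z] on a loss and by [(A + B *m K) *m Z] on a delivery. *)
have step b Z' : (forall w, loss_path N bs w -> lam N w = b ->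
    x N.+1 w = Z' *m x0 w) ->
  (\int[P]_(w in loss_path N.+1 (extend_path bs N b))
     (qform 1%:M (x (N + k.+1)%N w))%:E <=
   (loss_path_prob N bs * channel_prob b * (C * r ^+ k * energy Z'))%:E
     * init_energy)%E.
  move=> xE'; rewrite -addSnnS -loss_path_probS; apply: IH => w.
  by rewrite loss_pathS => -[bsw lamw]; exact: xE'.
have stepF := step false (A *m Z); have stepT := step true ((A + B *m K) *m Z).
apply: le_trans (leeD (stepF _) (stepT _)) _.
- by move=> w /xE xw lamw; rewrite /x /= -/(x N w) lamw scale0r addr0 xw mulmxA.
- move=> w /xE xw lamw; rewrite /x /= -/(x N w) lamw scale1r xw.
  by rewrite mulmxDl -!mulmxA mulmxDl -!mulmxA.
rewrite -(fineK init_energy_fin) -!EFinM -EFinD lee_fin -mulrDl.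
apply: ler_wpM2r.
  by rewrite fine_ge0//; apply: integral_ge0 => w _; rewrite lee_fin qform1_ge0.
(* Once the path probability, [C] and [r ^+ k] are factored out, the weights [q] and [1 - q] of the
   two branches leave exactly the contraction of [energy], which supplies the missing factor [r]. *)
rewrite -!mulrA -mulrDr ler_wpM2l ?loss_path_prob_ge0//=.
rewrite !(mulrCA _ C) -mulrDr ler_wpM2l//.
rewrite !(mulrCA _ (r ^+ k)) -mulrDr exprSr -mulrA ler_wpM2l ?exprn_ge0//.
exact: energy_contracts.
Qed.

Lemma ms_stable_lyapunov : r < 1 -> ms_stable P x.
Proof.
move=> r_lt1; rewrite /ms_stable.
pose bound t : R := C * energy 1%:M * fine init_energy * r ^+ t.
have E0 : 0 <= fine init_energy.
  by rewrite fine_ge0//; apply: integral_ge0 => w _; rewrite lee_fin qform1_ge0.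
have energyE t : ('E_P[fun w => ((x t w)^T *m x t w) ord0 ord0] =
    \int[P]_w (qform 1%:M (x t w))%:E)%E.
  by rewrite unlock; apply: eq_integral => w _; rewrite /qform mulmx1.
apply: (@squeeze_cvge _ _ _ _ (cst 0%E) _ (EFin \o bound)).
- near=> t; rewrite /= energyE; apply/andP; split.
    by apply: integral_ge0 => w _; rewrite lee_fin qform1_ge0.
  (* The empty path is the whole space, and there [x0] is its own image under the identity; the
     sequence chosen is irrelevant. *)
  have := @integral_sqnorm_state_le t 0 (fun=> true) 1%:M.
  rewrite (_ : loss_path 0 _ = setT); last by apply/seteqP; split.
  rewrite add0n => /(_ (fun w _ => esym (mul1mx (x0 w)))) /le_trans; apply.
  rewrite -(fineK init_energy_fin) -EFinM lee_fin /loss_path_prob big_ord0 mul1r.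
  suff -> : bound t = C * r ^+ t * energy 1%:M * fine init_energy by [].
  by rewrite /bound; ring.
- exact: cvg_cst.
- apply/fine_cvgP; split; first by near=> t.
  by apply: cvg_geometric; rewrite ger0_norm.
Unshelve. all: by end_near.
Qed.

End Trajectories.

Theorem theorem2 (R : realType) (n m : nat)
  (A : 'M[R]_n) (B : 'M[R]_(n, m)) (Q : 'M[R]_n) (Rm : 'M[R]_m)
  (q qhat : R) (Phat : 'M[R]_n) :
  posdef Q -> posdef Rm -> stabilizable A B ->
  0 < q < 1 -> q < critical_prob A B Q Rm ->
  0 <= qhat -> qhat < critical_prob A B Q Rm ->
  mare_pd_solution A B Q Rm qhat Phat ->
  (posdef (ce_condition_matrix A B Q Rm q qhat Phat) ->
    forall (d : measure_display) (T : measurableType d) (P : probability T R)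
      (x0 : T -> 'cV[R]_n) (lam : nat -> T -> bool),
    finite_second_moment P x0 ->
    bernoulli_loss P q lam ->
    indep_init_loss P x0 lam ->
    ms_stable P (cl_state A B (ce_gain A B Rm Phat) x0 lam))
  /\ (q <= qhat -> posdef (ce_condition_matrix A B Q Rm q qhat Phat)).
Proof.
move=> pQ pRm _ /andP[q_gt0 q_lt1] _ _ _ [pP PE]; split; last first.
  by move=> qq; apply: posdef_ce_condition => //; exact: ltW.
move=> pM d T P x0 lam x0_moment lam_loss indep.
(* [Phat] serves as the Lyapunov form. By [gain_drift] its mean one-step value is [Phat] minus the
   condition matrix, which [rM] bounds by [r] times [Phat]. *)
have [r /andP[r_ge0 r_lt1] rM] := posdef_le_scale Phat pM.
have [C C_ge0 CP] := posdef_coercive pP.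
have P_ge0 y := posdef_qform_ge0 y pP.
apply: (ms_stable_lyapunov _ x0_moment lam_loss indep r_ge0 C_ge0 P_ge0 CP) => //.
  by rewrite !ltW.
by move=> y; rewrite (gain_drift pRm pP q y PE) rM.
Qed.
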